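(* The condition $D\ge Z$ does not suffice: no algorithm can guarantee reliable broadcast on all 4-connected planar graphs with all placements of Byzantine nodes satisfying $D \ge Z$, where $Z$ is the maximal number of edges of a polygon of the graph and $D$ is the minimal distance (in hops) between two distinct Byzantine nodes.
   Context: A planar graph is considered with a fixed planar embedding; a polygon is a circular path (sequence of nodes $(u_1,\dots,u_n)$, consecutive nodes adjacent and $u_n,u_1$ adjacent) that does not surround any node in the embedding. A graph is 4-connected if removing any set of fewer than 4 nodes leaves it connected. Nodes are correct or Byzantine (arbitrary, possibly malicious behavior, unknown to correct nodes). Network model: nodes communicate only with neighbors by messages, asynchronously (messages eventually received, arbitrary delays, every process activated infinitely often), over authenticated channels (receiver knows the identity of the sending neighbor). A correct source node wants to broadcast an information $m_0$; a node delivers $m$ when it permanently considers $m$ to be the source's information. Reliable broadcast means all correct nodes eventually deliver $m_0$.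
   Formalization: Polygons are taken to be the boundaries of bounded faces; if every circular path surrounding no node counted, a Hamiltonian cycle (Tutte) would give Z at least the number of nodes, so D ≥ Z would allow at most one Byzantine node and the claim would be false. *)

(* Defs.v *)
From mathcomp Require Import all_boot.

Set Implicit Arguments.
Unset Strict Implicit.
Unset Printing Implicit Defensive.

(* A connected simple graph embedded in the plane, given by its rotation
   system: [pg_rot v u] is the neighbour that follows [u] around [v].  A dart
   is an ordered pair of adjacent nodes; the orbits of [face_next] on the darts
   are the boundary walks of the faces.  For a connected graph, Euler's formula
   #nodes + #faces = #edges + 2 says exactly that the rotation system embeds
   the graph in the sphere; distinguishing one face as the unbounded one makes
   this an embedding in the plane. *)

Definition darts (V : finType) (adj : rel V) : {set V * V} :=
  [set d | adj d.1 d.2].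

Definition face_next (V : finType) (rot : V -> V -> V) (d : V * V) : V * V :=
  (d.2, rot d.2 d.1).

Definition face_of (V : finType) (rot : V -> V -> V) (d : V * V) :
    {set V * V} :=
  [set e | fconnect (face_next rot) d e].

Definition faces_of (V : finType) (adj : rel V) (rot : V -> V -> V) :
    {set {set V * V}} :=
  [set face_of rot d | d in darts adj].

Record plane_graph : Type := PlaneGraph {
  pg_node :> finType;
  pg_adj : rel pg_node;
  pg_sym : symmetric pg_adj;
  pg_irr : irreflexive pg_adj;
  pg_connected : forall u v, connect pg_adj u v;
  pg_rot : pg_node -> pg_node -> pg_node;
  (* [pg_rot v] permutes the neighbours of [v] in a single cycle *)
  pg_rot_cyclic : forall v u, pg_adj v u -> fconnect (pg_rot v) u =i pg_adj v;
  (* each edge carries two darts *)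
  pg_euler : #|pg_node| + #|faces_of pg_adj pg_rot|
             = #|darts pg_adj|./2 + 2;
  (* a dart of the unbounded face *)
  pg_outer : pg_node * pg_node;
  pg_outer_dart : pg_outer \in darts pg_adj
}.

Definition four_connected (G : plane_graph) : Prop :=
  forall S : {set G}, #|S| < 4 ->
  forall u v : G, u \notin S -> v \notin S ->
  connect [rel x y | [&& pg_adj x y, x \notin S & y \notin S]] u v.

(* The polygons are the circuits bounding the bounded faces.  "Surrounds no
   node" is thus read as "has nothing of the graph in its interior": otherwise
   gluing two faces along an edge would again give a polygon (and a 6-edge one
   in a square grid).  A polygon is represented by the set of darts of its
   boundary walk, so its cardinal is its number of edges. *)
Definition polygons (G : plane_graph) : {set {set G * G}} :=
  faces_of (@pg_adj G) (@pg_rot G) :\ face_of (@pg_rot G) (pg_outer G).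

Definition max_polygon (G : plane_graph) : nat :=
  \max_(F in polygons G) #|F|.

Definition walk_of_length (G : plane_graph) (u v : G) (k : nat) : bool :=
  [exists p : k.-tuple G, path (@pg_adj G) u p && (last u p == v)].

Lemma exists_walk (G : plane_graph) (u v : G) :
  exists k, walk_of_length u v k.
Proof.
have /connectP[p up ->] := pg_connected u v.
by exists (size p); apply/existsP; exists (in_tuple p); rewrite up eqxx.
Qed.

Definition hop_dist (G : plane_graph) (u v : G) : nat :=
  ex_minn (exists_walk u v).

(* D >= k, where D is the minimum of the distances between two distinct
   elements of [B] (with D = +oo when there is no such pair). *)
Definition min_dist_ge (G : plane_graph) (B : {set G}) (k : nat) : Prop :=
  forall b b' : G, b \in B -> b' \in B -> b != b' -> k <= hop_dist b b'.

(* The local program of the nodes.  A step of node [v] consumes at most one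
   message, tagged with the neighbour that sent it, and produces a new state
   and a list of messages tagged with their addressees.  Steps may be
   nondeterministic but are never blocked.  [init] receives the information to
   broadcast at the source and [None] elsewhere; [output] is the information
   that the node currently considers to be the source's. *)
Record protocol (Info : Type) (V : Type) : Type := Protocol {
  msg : Type;
  state : Type;
  init : V -> option Info -> state;
  step : V -> state -> option (V * msg) -> state -> seq (V * msg) -> Prop;
  step_total : forall v s r, exists s' out, step v s r s' out;
  output : V -> state -> option Info
}.

(* Nodes may know the network and the source, but not the Byzantine nodes. *)
Definition algorithm (Info : Type) : Type :=
  forall (G : plane_graph) (src : G), protocol Info G.

Section Executions.
Variables (Info : Type) (G : plane_graph) (src : G) (P : protocol Info G).
Variable B : {set G}. (* the Byzantine nodes *)

(* [sent u v] lists all messages ever sent from [u] to [v], and [got u v i]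
   tells whether the [i]-th of them has been received. *)
Record config : Type := Config {
  st : G -> state P;
  sent : G -> G -> seq (msg P);
  got : G -> G -> nat -> bool
}.

(* An activation [(v, None)] of [v] receives nothing; [(v, Some (u, i))]
   receives the [i]-th message sent from [u] to [v].  Channels need not be
   FIFO. *)
Definition activation : Type := (G * option (G * nat))%type.

Inductive receives (c : config) (v : G) :
    option (G * nat) -> option (G * msg P) -> Prop :=
| ReceivesNone : receives c v None None
| ReceivesSome u i m : onth (sent c u v) i = Some m -> ~~ got c u v i ->
    receives c v (Some (u, i)) (Some (u, m)).

(* Only correct nodes have to follow the protocol: the new state and the sent
   messages [out] of a Byzantine node are arbitrary.  In all cases messages
   travel only between neighbours, under the identity of their real sender. *)
Definition transition (c : config) (a : activation) (c' : config) : Prop :=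
  exists r out,
  [/\ receives c a.1 a.2 r,
      a.1 \notin B -> step a.1 (st c a.1) r (st c' a.1) out,
      forall v, v != a.1 -> st c' v = st c v,
      forall u v, sent c' u v =
        if (u == a.1) && pg_adj u v
        then sent c u v ++ [seq x.2 | x <- out & x.1 == v]
        else sent c u v
    & forall u v i, got c' u v i =
        got c u v i || ((v == a.1) && (a.2 == Some (u, i)))].

Definition initial (m0 : Info) (c : config) : Prop :=
  [/\ forall v, st c v = init P v (if v == src then Some m0 else None),
      forall u v, sent c u v = [::]
    & forall u v i, got c u v i = false].

Definition fair (c : nat -> config) (a : nat -> activation) : Prop :=
  (forall v t, exists2 t', t <= t' & (a t').1 = v) /\
  (forall u v i t, i < size (sent (c t) u v) -> exists t', got (c t') u v i).

Definition execution (m0 : Info) (c : nat -> config) (a : nat -> activation) :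
    Prop :=
  [/\ initial m0 (c 0), forall t, transition (c t) (a t) (c t.+1) & fair c a].

Definition delivers (c : nat -> config) (v : G) (m : Info) : Prop :=
  exists t, forall t', t <= t' -> output v (st (c t') v) = Some m.

Definition reliable_broadcast : Prop :=
  forall (m0 : Info) (c : nat -> config) (a : nat -> activation),
  execution m0 c a -> forall v, v \notin B -> delivers c v m0.

End Executions.

(* Main.v *)
Require Import Defs.
From mathcomp Require Import all_boot.
From Stdlib Require Import IndefiniteDescription.

(* The middle ring c0 c1 c2 c3 of the graph below is a vertex cut, and each of
   {c0, c2} and {c1, c3} consists of two nodes at distance 4 = Z.  In world 0 the
   source broadcasts m and {c0, c2} is Byzantine, in world 1 it broadcasts m' and
   {c1, c3} is Byzantine.  Both worlds are run jointly, each Byzantine node of a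
   world copying what its correct self does in the other world: the nodes on the
   far side of the cut then go through the same states in both worlds, so they
   cannot deliver m in one and m' in the other. *)

Set Implicit Arguments.
Unset Strict Implicit.
Unset Printing Implicit Defensive.

(** * Joint runs of two worlds *)

Section TwoWorlds.

Variables (Info : Type) (G : plane_graph) (src : G) (P : protocol Info G).
Variables (B : bool -> {set G}) (T : {set G}) (m : bool -> Info).
Hypothesis B_disjoint : [disjoint B false & B true].
Hypothesis T_correct : forall w, [disjoint T & B w].
Hypothesis src_notin_T : src \notin T.
Hypothesis T_cut : forall u v, pg_adj u v -> v \in T ->
  u \in T \/ exists w, u \in B w.

(** Choice turns the nondeterministic [step] into a function, so that equal states and inputs in the
    two worlds give equal behaviour. *)
Definition next_step v s r : state P * seq (G * msg P) :=
  let: exist s' h := constructive_indefinite_description _ (@step_total _ _ P v s r) in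
  (s', sval (constructive_indefinite_description _ h)).

Lemma next_stepP v s r : step v s r (next_step v s r).1 (next_step v s r).2.
Proof.
rewrite /next_step; case: constructive_indefinite_description => s' h.
exact: svalP (constructive_indefinite_description _ h).
Qed.

(* Any value recurs at the times [2 ^ n * (2 * k).+1], for a fixed [n]. *)
Definition schedule (t : nat) : option (G * (G * nat)) := unpickle (logn 2 t).

Lemma schedule_recurs x t : exists2 t', t <= t' & schedule t' = Some x.
Proof.
exists (2 ^ pickle x * t.*2.+1).
  by rewrite -[t]mul1n leq_mul ?expn_gt0 // mul1n -addnn ltnW // ltnS leq_addr.
rewrite /schedule lognM ?expn_gt0 // pfactorK // logn_coprime ?addn0 ?pickleK //.
by rewrite coprime2n /= odd_double.
Qed.

(** The slot [(a, (b, i))] activates [a] and offers it the [i]-th message from [b]; the default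
    fills the times that encode no triple. *)
Definition slot (t : nat) : G * (G * nat) := odflt (src, (src, 0)) (schedule t).

Lemma slot_recurs x t : exists2 t', t <= t' & slot t' = x.
Proof.
by have [t' tt' xt'] := schedule_recurs x t; exists t'; rewrite // /slot xt'.
Qed.

Definition pending (c : config P) (v u : G) (i : nat) : option (msg P) :=
  if got c u v i then None else onth (sent c u v) i.

Definition received (c : config P) v u i : option (G * msg P) :=
  omap (pair u) (pending c v u i).

Definition receipt (c : config P) v u i : option (G * nat) :=
  omap (fun=> (u, i)) (pending c v u i).

Lemma receivesP c v u i : receives c v (receipt c v u i) (received c v u i).
Proof.
rewrite /receipt /received /pending; case: ifPn => /= got_i; first exact: ReceivesNone.
by case def_m: onth => [x|] /=; [apply: ReceivesSome | apply: ReceivesNone].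
Qed.

(* A Byzantine node of world [w] imitates its correct copy in the other world. *)
Definition model (w : bool) (v : G) : bool := if v \in B w then ~~ w else w.

Definition reaction (c : bool -> config P) (w : bool) v u i :=
  next_step v (st (c (model w v)) v) (received (c (model w v)) v u i).

(** A copied reaction comes from the other world, incoming message included, but the reception is
    recorded in world [w] itself, where the transition takes place. *)
Definition advance (x : G * (G * nat)) (c : bool -> config P) (w : bool) : config P :=
  let: (a, (b, i)) := x in
  let r := reaction c w a b i in
  Config (fun v => if v == a then r.1 else st (c w) v)
    (fun u v => if (u == a) && pg_adj u v
                then sent (c w) u v ++ [seq y.2 | y <- r.2 & y.1 == v]
                else sent (c w) u v)
    (fun u v j => got (c w) u v j
                  || ((v == a) && (receipt (c w) a b i == Some (u, j)))).

Definition start (w : bool) : config P :=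
  Config (fun v => init P v (if v == src then Some (m w) else None))
    (fun _ _ => [::]) (fun _ _ _ => false).

Fixpoint joint_run (t : nat) : bool -> config P :=
  if t is t'.+1 then advance (slot t') (joint_run t') else start.

Definition run w t := joint_run t w.

Definition activity w t : activation G :=
  let: (a, (b, i)) := slot t in (a, receipt (run w t) a b i).

Lemma run_transition w t : transition (B w) (run w t) (activity w t) (run w t.+1).
Proof.
rewrite /run /activity /= /advance; case: (slot t) => a [b i].
exists (received (run w t) a b i), (reaction (joint_run t) w a b i).2; split=> //=.
- exact: receivesP.
- by rewrite eqxx /reaction /model => /negPf->; apply: next_stepP.
- by move=> v /negPf->.
Qed.

Lemma run_sent_size w u v t t' :
  t <= t' -> size (sent (run w t) u v) <= size (sent (run w t') u v).
Proof.
move/subnK<-; elim: (t' - t) => // k IHk; rewrite addSn.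
have [r [out [_ _ _ -> _]]] := run_transition w (k + t).
by case: ifP => _ //; rewrite size_cat (leq_trans IHk) ?leq_addr.
Qed.

Lemma run_fair w : fair (run w) (activity w).
Proof.
split=> [v t | u v i t it].
  have [t' tt' slot_t'] := slot_recurs (v, (src, 0)) t.
  by exists t'; rewrite // /activity slot_t'.
(* The slot of this message recurs; by then the message is still in the channel, so it is received
   now unless it was before. *)
have [t' tt' slot_t'] := slot_recurs (v, (u, i)) t.
exists t'.+1; have [r [out [_ _ _ _ ->]]] := run_transition w t'.
rewrite /activity slot_t' /= eqxx /= /receipt /pending.
case: ifP => //= _; case def_x: onth => [x|] /=; first by rewrite eqxx.
by have := onthTE (sent (run w t') u v) i; rewrite def_x (leq_trans it) ?run_sent_size.
Qed.

Lemma run_execution w : execution src (B w) (m w) (run w) (activity w).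
Proof. by split; [split | apply: run_transition | apply: run_fair]. Qed.

(** * Indistinguishability on the far side of the cut *)

Lemma model_neg w v : v \in B w -> model (~~ w) v = model w v.
Proof.
have dis : (v \in B (~~ w)) && (v \in B w) = false.
  move: (B_disjoint) => /pred0P/(_ v) /=; case: w => //=; by rewrite andbC.
by move=> vB; move: dis; rewrite /model vB andbT => ->.
Qed.

Lemma model_T w v : v \in T -> model w v = w.
Proof. by move=> vT; rewrite /model (disjointFr (T_correct w) vT). Qed.

(** A slot may name a sender that is not a neighbour, a case outside [T_cut]. *)
Lemma run_sent_nonadj w t u v : ~~ pg_adj u v -> sent (run w t) u v = [::].
Proof.
move=> uv; elim: t => // t IHt.
by have [r [out [_ _ _ -> _]]] := run_transition w t; rewrite (negPf uv) andbF.
Qed.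

(** The invariant collects what [T] can observe; the channels leaving the cut belong to it because
    they feed [T]. *)
Definition agree (c : bool -> config P) : Prop :=
  [/\ forall v, v \in T -> st (c false) v = st (c true) v,
      forall u v, u \in T \/ (exists w, u \in B w) ->
        sent (c false) u v = sent (c true) u v
    & forall u v i, v \in T -> got (c false) u v i = got (c true) u v i].

Lemma pending_agree t v u i : agree (joint_run t) -> v \in T ->
  pending (joint_run t false) v u i = pending (joint_run t true) v u i.
Proof.
case=> _ agree_sent agree_got vT; rewrite /pending agree_got //.
case uv: (pg_adj u v); first by rewrite agree_sent //; apply: T_cut uv vT.
by have /negbT/run_sent_nonadj nil := uv; rewrite !(nil _ t : sent (joint_run t _) _ _ = _).
Qed.

(** In [T] this is the invariant. A node of the cut is Byzantine in exactly one world, so both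
    worlds model it on the other one and compute the very same reaction. *)
Lemma reaction_agree t a b i : agree (joint_run t) ->
  a \in T \/ (exists w, a \in B w) ->
  reaction (joint_run t) false a b i = reaction (joint_run t) true a b i.
Proof.
move=> agr [aT | [w aB]]; last first.
  by rewrite /reaction; case: w aB => /model_neg => [-> | <-].
case: (agr) => agree_st _ _.
by rewrite /reaction !model_T // agree_st // /received pending_agree.
Qed.

Lemma run_agree t : agree (joint_run t).
Proof.
elim: t => [|t IHt] /=.
  by split=> //= v vT; case: eqP vT src_notin_T => // -> ->.
case: (slot t) => a [b i]; have [agree_st agree_sent agree_got] := IHt.
split=> [v vT | u v uTB | u v j vT] /=.
- case: eqP => [eq_va | _]; last exact: agree_st.
  by rewrite reaction_agree // -eq_va; left.
- rewrite (agree_sent u v uTB); case: eqP => //= eq_ua.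
  by rewrite reaction_agree // -eq_ua.
- rewrite agree_got //; case: eqP => //= eq_va.
  by rewrite /receipt pending_agree -?eq_va.
Qed.

Lemma not_reliable_across_cut v :
  v \in T -> m false <> m true -> ~ forall w, reliable_broadcast src P (B w).
Proof.
move=> vT neq_m rb.
have deliver w : delivers (run w) v (m w).
  by apply: rb (run_execution w) _ _; move: (T_correct w) => /disjointFr->.
have [[t0 h0] [t1 h1]] := (deliver false, deliver true).
(* At this time both deliveries are permanent, yet [v] has a single state. *)
have [eq_st _ _] := run_agree (maxn t0 t1).
have := h0 _ (leq_maxl t0 t1); rewrite (eq_st v vT) h1 ?leq_maxr // => -[].
by move/esym.
Qed.

End TwoWorlds.

(** * Finite graphs given by adjacency lists *)

Fixpoint subseqs (T : Type) (n : nat) (s : seq T) : seq (seq T) :=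
  if s is x :: s' then
    (if n is n'.+1 then [seq x :: r | r <- subseqs n' s'] else [::])
      ++ subseqs n s'
  else [:: [::]].

Lemma mem_subseqs (T : eqType) n (s r : seq T) :
  subseq r s -> size r <= n -> r \in subseqs n s.
Proof.
elim: s n r => [|x s IHs] n r; first by rewrite subseq0 mem_seq1.
case: r => [|y r] /= rs rn; rewrite mem_cat.
  by rewrite (IHs n [::]) ?sub0seq ?orbT.
move: rs; case: eqP => [-> | _] rs; last by rewrite (IHs n) ?orbT.
by case: n rn => //= n rn; rewrite map_f //; apply: IHs.
Qed.

(* The quantifiers and cardinals of MathComp finite types do not compute, hence
   the explicit list of nodes. *)
Section AdjacencyLists.

Variables (V : finType) (nodes : seq V) (nbrs : V -> seq V).
Hypotheses (uniq_nodes : uniq nodes) (mem_nodes : forall v, v \in nodes).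

Definition list_adj : rel V := fun u v => v \in nbrs u.

Definition list_rot (v : V) : V -> V := next (nbrs v).

Lemma all_nodesP (p : pred V) : all p nodes -> forall v, p v.
Proof. by move=> /allP pall v; apply: pall. Qed.

Lemma list_adj_sym :
  all (fun u => all (fun v => list_adj u v == list_adj v u) nodes) nodes ->
  symmetric list_adj.
Proof. by move=> sym u v; exact/eqP/(all_nodesP (all_nodesP sym u)). Qed.

Lemma list_adj_irr :
  all (fun u => ~~ list_adj u u) nodes -> irreflexive list_adj.
Proof. by move=> irr u; exact/negbTE/(all_nodesP irr). Qed.

Lemma list_rot_cyclic :
  all (fun v => uniq (nbrs v)) nodes ->
  forall v u, list_adj v u -> fconnect (list_rot v) u =i list_adj v.
Proof.
move=> nbrs_uniq v u vu w; apply: fconnect_cycle vu w.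
exact/cycle_next/(all_nodesP nbrs_uniq).
Qed.

(** Declaring [s] already visited makes [dfs] explore the graph with [s] removed. *)
Definition connected_without (s : seq V) : bool :=
  if [seq v <- nodes | v \notin s] is u :: r then
    let c := dfs nbrs (size nodes) s u in all (fun v => v \in c) r
  else true.

Lemma connect_without n (S : {set V}) u v :
  symmetric list_adj -> all connected_without (subseqs n nodes) ->
  #|S| <= n -> u \notin S -> v \notin S ->
  connect [rel x y | [&& list_adj x y, x \notin S & y \notin S]] u v.
Proof.
move=> sym_adj all_con cardS uS vS; set e := [rel x y | _].
have e_sym : symmetric e by move=> x y; rewrite /= sym_adj [(y \notin S) && _]andbC.
have [s s_sub mem_s] : exists2 s, s \in subseqs n nodes & s =i S.
  exists [seq x <- nodes | x \in S]; last first.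
    by move=> x; rewrite mem_filter mem_nodes andbT.
  apply: mem_subseqs; first exact: filter_subseq.
  rewrite -(card_uniqP (filter_uniq _ uniq_nodes)); apply: leq_trans cardS.
  by apply/subset_leq_card/subsetP=> x; rewrite mem_filter => /andP[].
have cardV : #|V| <= size nodes.
  by rewrite -(card_uniqP uniq_nodes); apply/subset_leq_card/subsetP.
move/allP/(_ s s_sub): all_con; rewrite /connected_without.
case def_r: [seq x <- nodes | x \notin s] => [|r t].
  have := mem_filter (fun x => x \notin s) u nodes.
  by rewrite def_r mem_nodes mem_s uS.
move/allP=> con_r.
have con x : x \notin S -> connect e r x.
  move=> xS; have : x \in r :: t by rewrite -def_r mem_filter mem_nodes mem_s xS.
  rewrite inE => /predU1P[-> // | /con_r].
  case/dfs_pathP=> [||p rp -> dis]; rewrite ?mem_s ?(leq_trans cardV) ?leq_addl //.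
  elim: p r rp dis {def_r con_r} => [|y p IHp] r //= /andP[ry yp].
  rewrite disjoint_cons mem_s => /andP[rS dis].
  apply: connect_trans (IHp y yp dis); apply/connect1.
  by move: dis; rewrite disjoint_cons mem_s => /andP[yS _]; apply/and3P.
apply: connect_trans (con _ vS).
by rewrite (sym_connect_sym e_sym) con.
Qed.

(** * Counting edges and faces *)

Definition list_darts : seq (V * V) := [seq (u, v) | u <- nodes, v <- nbrs u].

Lemma darts_list_adj : darts list_adj = [set d in list_darts].
Proof.
apply/setP=> -[u v]; rewrite !inE /=; apply/idP/allpairsPdep.
  by move=> uv; exists u, v; rewrite mem_nodes.
by case=> x [y [_ xy [-> ->]]].
Qed.

Lemma card_list_darts : uniq list_darts -> #|darts list_adj| = size list_darts.
Proof. by rewrite darts_list_adj cardsE => /card_uniqP. Qed.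

Let fnext := face_next list_rot.

(* The boundary walk of a face known to be a triangle or a quadrilateral. *)
Definition face_walk (d : V * V) : seq (V * V) :=
  traject fnext d (if iter 3 fnext d == d then 3 else 4).

Lemma mem_face_walk d : d \in face_walk d.
Proof. by rewrite /face_walk; case: ifP => _; apply: mem_head. Qed.

Hypothesis short_faces : all (fun d => fcycle fnext (face_walk d)) list_darts.

Lemma face_of_walk r d :
  r \in list_darts -> d \in face_walk r ->
  face_of list_rot d = [set x in face_walk r].
Proof.
move=> rd dr; have /allP/(_ r rd) cyc := short_faces.
by apply/setP=> x; rewrite !inE (fconnect_cycle cyc).
Qed.

Lemma card_face d : d \in darts list_adj -> #|face_of list_rot d| <= 4.
Proof.
rewrite darts_list_adj inE => dd; rewrite (face_of_walk dd (mem_face_walk d)).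
by rewrite cardsE (leq_trans (card_size _)) // size_traject; case: ifP.
Qed.

Definition face_reps : seq (V * V) :=
  foldr (fun d rs => if has (fun r => d \in face_walk r) rs then rs else d :: rs)
    [::] list_darts.

Lemma face_reps_darts : {subset face_reps <= list_darts}.
Proof.
rewrite /face_reps; elim: list_darts => //= d ds IHds x.
case: ifP => _ => [/IHds xds|]; first by rewrite inE xds orbT.
by rewrite !inE => /predU1P[->|/IHds->]; rewrite ?eqxx ?orbT.
Qed.

(** The two checks make [face_reps] a system of representatives: every dart is on some listed walk,
    and no walk contains a later representative. *)
Lemma card_list_faces :
  (let reps := face_reps in
   all (fun d => has (fun r => d \in face_walk r) reps) list_darts) ->
  pairwise (fun r r' => r' \notin face_walk r) face_reps ->
  #|faces_of list_adj list_rot| = size face_reps.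
Proof.
move=> /allP cover; have reps_darts := face_reps_darts; move: cover.
move: face_reps reps_darts => reps reps_darts cover separate.
have -> : faces_of list_adj list_rot = [set F in [seq face_of list_rot r | r <- reps]].
  apply/setP=> F; rewrite inE; apply/imsetP/mapP=> -[d dd ->]; last first.
    by exists d; rewrite // darts_list_adj inE reps_darts.
  move: dd; rewrite darts_list_adj inE => /cover/hasP[r rr dr].
  have rd := reps_darts r rr.
  by exists r; rewrite // (face_of_walk rd dr) (face_of_walk rd (mem_face_walk r)).
rewrite cardsE -(size_map (face_of list_rot)); apply/card_uniqP.
rewrite uniq_pairwise pairwise_map.
move: separate; apply: (sub_in_pairwise (P := mem reps)); last exact/allP.
move=> r r' /reps_darts rd _ /=; apply: contraNneq => eq_rr'.
have := face_of_walk rd (mem_face_walk r).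
by rewrite eq_rr' => /setP/(_ r'); rewrite !inE connect0.
Qed.

Fixpoint walk_ends (k : nat) (u : V) : seq V :=
  if k is k'.+1 then flatten [seq walk_ends k' v | v <- nbrs u] else [:: u].

Lemma last_walk_ends u p : path list_adj u p -> last u p \in walk_ends (size p) u.
Proof.
elim: p u => [|v p IHp] u /=; first by rewrite mem_head.
by case/andP=> uv vp; apply/flatten_mapP; exists v => //; apply: IHp.
Qed.

End AdjacencyLists.

(** * The counterexample *)

(* The tower: five rings of four nodes, node [i] of ring [l] being [4 * l + i]
   and sitting at angle [i - l / 2] (in quarter turns), so that it is joined to
   the two nodes of each adjacent ring that are half a step away; the innermost
   and outermost rings are 4-cycles.  The neighbours are listed in rotation
   order.  The faces are squares, except for the triangles along these two
   4-cycles. *)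
Definition site (l i : nat) : 'I_20 :=
  Ordinal (ltn_pmod (4 * l + i %% 4) (isT : 0 < 20)).

(** Indices are cyclic, so [i + 3] is the predecessor of [i]. On the extreme rings, ring neighbours
    replace the missing adjacent ring. *)
Definition up_sites (l i : nat) : seq 'I_20 :=
  if l == 4 then [:: site 4 (i + 3); site 4 i.+1]
  else [:: site l.+1 i; site l.+1 i.+1].

Definition down_sites (l i : nat) : seq 'I_20 :=
  if l == 0 then [:: site 0 i.+1; site 0 (i + 3)]
  else [:: site l.-1 i; site l.-1 (i + 3)].

Definition tower_nbrs (v : 'I_20) : seq 'I_20 :=
  up_sites (v %/ 4) (v %% 4) ++ down_sites (v %/ 4) (v %% 4).

Definition tower_nodes : seq 'I_20 := [seq site (n %/ 4) n | n <- iota 0 20].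

Lemma uniq_tower_nodes : uniq tower_nodes.
Proof. by vm_compute. Qed.

Lemma mem_tower_nodes v : v \in tower_nodes.
Proof.
apply/mapP; exists (v : nat); first by rewrite mem_iota ltn_ord.
by apply/val_inj; rewrite /= mulnC -divn_eq modn_small.
Qed.

Notation tower_adj := (list_adj tower_nbrs).
Notation tower_rot := (list_rot tower_nbrs).

Lemma tower_sym : symmetric tower_adj.
Proof. by apply: (list_adj_sym mem_tower_nodes); vm_compute. Qed.

Lemma tower_irr : irreflexive tower_adj.
Proof. by apply: (list_adj_irr mem_tower_nodes); vm_compute. Qed.

Lemma tower_rot_cyclic v u : tower_adj v u -> fconnect (tower_rot v) u =i tower_adj v.
Proof. by apply: (list_rot_cyclic mem_tower_nodes); vm_compute. Qed.

Lemma tower_connect_without (S : {set 'I_20}) u v :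
  #|S| < 4 -> u \notin S -> v \notin S ->
  connect [rel x y | [&& tower_adj x y, x \notin S & y \notin S]] u v.
Proof.
apply: (connect_without uniq_tower_nodes mem_tower_nodes tower_sym).
by vm_compute.
Qed.

Lemma tower_connected u v : connect tower_adj u v.
Proof.
have := @tower_connect_without set0 u v; rewrite cards0 !inE => /(_ isT isT isT).
by apply: connect_sub => x y /and3P[xy _ _]; apply: connect1.
Qed.

Lemma tower_short_faces :
  all (fun d => fcycle (face_next tower_rot) (face_walk tower_nbrs d))
    (list_darts tower_nodes tower_nbrs).
Proof. by vm_compute. Qed.

(** The count is 20 + 22 = 40 + 2, with 14 quadrilaterals and 8 triangles. *)
Lemma tower_euler :
  #|'I_20| + #|faces_of tower_adj tower_rot| = #|darts tower_adj|./2 + 2.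
Proof.
rewrite card_ord (card_list_darts mem_tower_nodes); last by vm_compute.
rewrite (card_list_faces mem_tower_nodes tower_short_faces).
- by vm_compute.
- by vm_compute.
- by vm_compute.
Qed.

(** This face is a triangle, but any choice would do: all faces have at most 4 edges. *)
Lemma tower_outer_dart : (site 0 0, site 0 1) \in darts tower_adj.
Proof. by rewrite inE; vm_compute. Qed.

Definition tower : plane_graph :=
  PlaneGraph tower_sym tower_irr tower_connected tower_rot_cyclic tower_euler
    tower_outer_dart.

Lemma tower_four_connected : four_connected tower.
Proof. by move=> S cardS u v; apply: tower_connect_without. Qed.

Lemma tower_max_polygon : max_polygon tower <= 4.
Proof.
apply/bigmax_leqP => F /setD1P[_ /imsetP[d dd ->]].
exact: card_face mem_tower_nodes tower_short_faces _ dd.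
Qed.

Lemma tower_hop_dist (u v : tower) k :
  all (fun j => v \notin walk_ends tower_nbrs j u) (iota 0 k) -> k <= hop_dist u v.
Proof.
move/allP=> far; rewrite /hop_dist; case: ex_minnP => j /existsP[p /andP[up /eqP pv]] _.
rewrite leqNgt; apply/negP=> jk; have /far/negP[] : j \in iota 0 k by rewrite mem_iota.
by have := last_walk_ends up; rewrite pv size_tuple.
Qed.

(** * Byzantine nodes and victims *)

Definition liar_seq (w : bool) : seq 'I_20 :=
  if w then [:: site 2 1; site 2 3] else [:: site 2 0; site 2 2].

Definition liars (w : bool) : {set tower} := [set v in liar_seq w].

(** An edge between rings turns by an eighth of a turn, so opposite nodes of the middle ring are 4
    such edges apart. A shortcut along an extreme ring costs 4 edges to get there and back; this is
    why there are two rings on each side. *)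
Lemma liars_far w : min_dist_ge (liars w) (max_polygon tower).
Proof.
move=> b b' bw b'w bb'; apply: leq_trans tower_max_polygon _.
apply: tower_hop_dist; move: bw b'w bb'.
by case: w; rewrite !inE => /orP[]/eqP-> /orP[]/eqP->; rewrite ?eqxx // => _; vm_compute.
Qed.

Lemma liars_disjoint : [disjoint liars false & liars true].
Proof.
have h : all (fun v => ~~ ((v \in liar_seq false) && (v \in liar_seq true))) tower_nodes.
  by vm_compute.
by apply/pred0P=> v; apply/negbTE; rewrite /= !in_set;
  exact: (all_nodesP mem_tower_nodes h v).
Qed.

Definition victims : {set tower} := [set v : 'I_20 | v < 8].

Lemma victims_correct w : [disjoint victims & liars w].
Proof.
have h : all (fun v : 'I_20 => ~~ ((v < 8) && (v \in liar_seq w))) tower_nodes.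
  by case: w; vm_compute.
by apply/pred0P=> v; apply/negbTE; rewrite /= !in_set;
  exact: (all_nodesP mem_tower_nodes h v).
Qed.

(** The victims are rings 0 and 1, entered from outside only through ring 2, which the liars of the
    two worlds fill. *)
Lemma victims_cut (u v : tower) :
  pg_adj u v -> v \in victims -> u \in victims \/ exists w, u \in liars w.
Proof.
have h : all (fun u => all (fun v : 'I_20 => tower_adj u v && (v < 8) ==>
    [|| u < 8, u \in liar_seq false | u \in liar_seq true]) tower_nodes) tower_nodes.
  by vm_compute.
move=> uv; rewrite !in_set => v8.
have /implyP := all_nodesP mem_tower_nodes (all_nodesP mem_tower_nodes h u) v.
rewrite v8 andbT => /(_ uv)/or3P[u8 | uB | uB]; first by left.
  by right; exists false; rewrite in_set.
by right; exists true; rewrite in_set.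
Qed.

Theorem theorem2 (Info : Type) (Info_nontrivial : exists m m' : Info, m <> m') :
  ~ exists A : algorithm Info,
      forall (G : plane_graph) (B : {set G}) (src : G),
        four_connected G ->
        min_dist_ge B (max_polygon G) ->
        src \notin B ->
        reliable_broadcast src (A G src) B.
Proof.
case=> A reliable; have [m0 [m1 neq_m]] := Info_nontrivial.
pose src : tower := site 4 0; pose victim : tower := site 0 0.
have src_correct w : src \notin liars w by rewrite in_set; case: w; vm_compute.
have src_far : src \notin victims by rewrite in_set.
have victim_far : victim \in victims by rewrite in_set.
(* Both worlds run the same protocol, since it depends on the network and the source but not on the
   Byzantine nodes. *)
apply: (not_reliable_across_cut (P := A tower src) (m := fun w => if w then m1 else m0)
  liars_disjoint victims_correct src_far victims_cut victim_far neq_m).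
move=> w; apply: reliable; [exact: tower_four_connected | exact: liars_far |].
exact: src_correct.
Qed.
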